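(* Let $f:\mathbb{R}^N\to\mathbb{R}$ be convex and differentiable with $L$-Lipschitz continuous gradient (with respect to $\|\cdot\|_2$), and let $x^*$ be a minimizer of $f$. Suppose that, for some $\mu>0$, $f$ is $\mu$-strongly convex or, more generally, satisfies the Polyak–Łojasiewicz condition $\|\nabla f(x)\|_2^2\ge2\mu\,(f(x)-f(x^* ))$ for all $x\in\mathbb{R}^N$. Let $(x^k),(y^k),(v^k),(a_k),(A_k)$ be generated by the Accelerated Alternating Minimization algorithm described in the context, which does not use the value of $\mu$ (in either its known-$L$ or its unknown-$L$ variant). Then for every $k\ge0$ \[ f(x^{k+1})-f(x^* )\;\le\;\prod_{i=0}^{k-1}\Bigl(1-\frac{\mu}{\hat L_i}\Bigr)\cdot\bigl(f(x^0)-f(x^* )\bigr),\qquad \hat L_i=\frac{A_i+a_{i+1}}{a_{i+1}^2}. \]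
   Context: The index set $\{1,\dots,N\}$ of the standard orthonormal basis $e_1,\dots,e_N$ of $\mathbb{R}^N$ is partitioned into $n$ disjoint blocks $I_1,\dots,I_n$. For $x\in\mathbb{R}^N$ put $S_i(x)=x+\operatorname{span}\{e_j: j\in I_i\}$, and let $\nabla_i f(x)$ denote the vector of partial derivatives of $f$ with respect to the coordinates in block $I_i$. It is assumed that $f$ can be minimized exactly over each $S_i(x)$. Accelerated Alternating Minimization algorithm, run with its strong convexity input parameter equal to $0$. Given $x^0\in\mathbb{R}^N$, set $v^0=x^0$, $A_0=0$, $\psi_0(x)=\frac12\|x-x^0\|_2^2$. For $k=0,1,2,\dots$: 1. $\beta_k\in\arg\min_{\beta\in[0,1]} f\bigl(x^k+\beta(v^k-x^k)\bigr)$, $y^k=x^k+\beta_k(v^k-x^k)$. 2. $i_k\in\arg\max_{i\in\{1,\dots,n\}}\|\nabla_i f(y^k)\|_2^2$ and $x^{k+1}\in\arg\min_{x\in S_{i_k}(y^k)} f(x)$. 3. If $L$ is known, $a_{k+1}>0$ is found from $\frac{a_{k+1}^2}{A_k+a_{k+1}}=\frac1{Ln}$. If $L$ is not known, $a_{k+1}>0$ is found from $f(y^k)-\frac{a_{k+1}^2}{2(A_k+a_{k+1})}\|\nabla f(y^k)\|_2^2=f(x^{k+1})$. 4. $A_{k+1}=A_k+a_{k+1}$. 5. $\psi_{k+1}(x)=\psi_k(x)+a_{k+1}\{f(y^k)+\langle\nabla f(y^k),x-y^k\rangle\}$ and $v^{k+1}=\arg\min_{x\in\mathbb{R}^N}\psi_{k+1}(x)$.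 The steps are assumed to be well defined; in the unknown-$L$ variant, determining $a_{k+1}$ from its equation presupposes $\nabla f(y^k)\ne0$ at the iterations considered. An empty product equals $1$. *)

(* Defs.v *)
From mathcomp Require Import all_boot all_order all_algebra.
From mathcomp Require Import all_classical all_reals all_analysis.

Set Implicit Arguments.
Unset Strict Implicit.
Unset Printing Implicit Defensive.

Import Order.TTheory GRing.Theory Num.Theory.
Import numFieldNormedType.Exports.

Local Open Scope classical_set_scope.
Local Open Scope ring_scope.

(* The library norm on 'rV[R]_N is the sup norm, hence an explicit 2-norm; the
   library notions of limit, [differentiable] and ['D_v] on 'rV[R]_N are used
   as they are, since both norms induce the same topology. *)
Definition dotr (R : realType) (N : nat) (u w : 'rV[R]_N) : R :=
  \sum_(j < N) u 0 j * w 0 j.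

Definition norm2 (R : realType) (N : nat) (u : 'rV[R]_N) : R :=
  Num.sqrt (dotr u u).

Definition is_argmin (R : realType) (T : Type) (D : set T) (g : T -> R) (z : T) :
    Prop :=
  D z /\ forall w, D w -> g z <= g w.

Definition is_argmax (R : realType) (T : Type) (D : set T) (g : T -> R) (z : T) :
    Prop :=
  D z /\ forall w, D w -> g w <= g z.

Definition e_ (R : realType) (N : nat) (j : 'I_N) : 'rV[R]_N := delta_mx 0 j.

Definition grad (R : realType) (N : nat) (f : 'rV[R]_N -> R) (x : 'rV[R]_N) :
    'rV[R]_N :=
  \row_(j < N) 'D_(e_ R j) f x.

Definition lipschitz_grad (R : realType) (N : nat) (L : R)
    (f : 'rV[R]_N -> R) : Prop :=
  forall x y, norm2 (grad f x - grad f y) <= L * norm2 (x - y).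

Definition strongly_convex (R : realType) (N : nat) (mu : R)
    (f : 'rV[R]_N -> R) : Prop :=
  forall (x y : 'rV[R]_N) (t : R), 0 <= t <= 1 ->
    f (t *: x + (1 - t) *: y) <=
      t * f x + (1 - t) * f y - mu / 2 * t * (1 - t) * norm2 (x - y) ^+ 2.

Definition polyak_lojasiewicz (R : realType) (N : nat) (mu : R)
    (f : 'rV[R]_N -> R) (xs : 'rV[R]_N) : Prop :=
  forall x, 2 * mu * (f x - f xs) <= norm2 (grad f x) ^+ 2.

Definition block_partition (N n : nat) (I : 'I_n -> {set 'I_N}) : Prop :=
  (\bigcup_(i < n) I i)%SET = [set: 'I_N]%SET /\
  forall i i' : 'I_n, i != i' -> ([disjoint I i & I i'])%B.

Definition block_space (R : realType) (N n : nat) (I : 'I_n -> {set 'I_N})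
    (i : 'I_n) (x : 'rV[R]_N) : set 'rV[R]_N :=
  [set x + d | d in
    [set d | d \in <<[seq e_ R j | j in I i]>>%VS]].

Definition block_grad (R : realType) (N n : nat) (I : 'I_n -> {set 'I_N})
    (i : 'I_n) (f : 'rV[R]_N -> R) (x : 'rV[R]_N) : 'rV[R]_#|I i| :=
  \row_(l < #|I i|) grad f x 0 (enum_val l).

(* The entry a 0 of the sequence of step sizes is never used. *)
Fixpoint psi (R : realType) (N : nat) (f : 'rV[R]_N -> R) (x0 : 'rV[R]_N)
    (y : nat -> 'rV[R]_N) (a : nat -> R) (k : nat) (z : 'rV[R]_N) : R :=
  match k with
  | 0%N => 2^-1 * norm2 (z - x0) ^+ 2
  | k'.+1 => psi f x0 y a k' z +
      a k'.+1 * (f (y k') + dotr (grad f (y k')) (z - y k'))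
  end.

Inductive aam_variant := KnownL | UnknownL.

Definition aam_line_search (R : realType) (N : nat) (f : 'rV[R]_N -> R)
    (x y v : nat -> 'rV[R]_N) (k : nat) : Prop :=
  exists beta : R,
    is_argmin `[0, 1] (fun b : R => f (x k + b *: (v k - x k))) beta /\
    y k = x k + beta *: (v k - x k).

Definition aam_block_min (R : realType) (N n : nat) (I : 'I_n -> {set 'I_N})
    (f : 'rV[R]_N -> R) (x y : nat -> 'rV[R]_N) (k : nat) : Prop :=
  exists i : 'I_n,
    is_argmax [set: 'I_n] (fun i' => norm2 (block_grad I i' f (y k)) ^+ 2) i /\
    is_argmin (block_space I i (y k)) f (x k.+1).

Definition aam_step_size (R : realType) (N n : nat) (L : R) (var : aam_variant)
    (f : 'rV[R]_N -> R) (x y : nat -> 'rV[R]_N) (a A : nat -> R) (k : nat) :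
    Prop :=
  0 < a k.+1 /\
  match var with
  | KnownL => a k.+1 ^+ 2 / (A k + a k.+1) = 1 / (L * n%:R)
  | UnknownL =>
      grad f (y k) != 0 /\
      f (y k) - a k.+1 ^+ 2 / (2 * (A k + a k.+1)) * norm2 (grad f (y k)) ^+ 2
        = f (x k.+1)
  end.

(* The sequences are produced by the method through the computation of x^{K+1}:
   the point updates are carried out at the iterations 0, ..., K and the updates
   of a, A and v at the iterations 0, ..., K - 1.  A nonterminating execution
   satisfies this for every K.  An execution of the variant with unknown L that
   stops because the gradient vanishes at y^K is covered up to that K. *)
Record aam_run (R : realType) (N n : nat) (I : 'I_n -> {set 'I_N}) (L : R)
    (var : aam_variant) (f : 'rV[R]_N -> R) (x y v : nat -> 'rV[R]_N)
    (a A : nat -> R) (K : nat) : Prop := AamRun {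
  aam_v0 : v 0%N = x 0%N;
  aam_A0 : A 0%N = 0;
  aam_y : forall k, (k <= K)%N -> aam_line_search f x y v k;
  aam_x : forall k, (k <= K)%N -> aam_block_min I f x y k;
  aam_a : forall k, (k < K)%N -> aam_step_size n L var f x y a A k;
  aam_A : forall k, (k < K)%N -> A k.+1 = A k + a k.+1;
  aam_v : forall k, (k < K)%N ->
    is_argmin [set: 'rV[R]_N] (psi f (x 0%N) y a k.+1) (v k.+1)
}.

Definition Lhat (R : realType) (a A : nat -> R) (i : nat) : R :=
  (A i + a i.+1) / a i.+1 ^+ 2.

(* Main.v *)
(* One iteration gives f(x^{k+1}) <= f(y^k) - |grad f(y^k)|^2 / (2 Lhat_k): by
   the choice of a_{k+1} when L is unknown, and when L is known because
   Lhat_k = L n and the largest block gradient carries at least 1/n of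
   |grad f(y^k)|^2.  With the Polyak-Lojasiewicz condition this contracts
   f - f(xs) from y^k to x^{k+1} by the factor 1 - mu / Lhat_k, while the line
   search gives f(y^k) <= f(x^k).  Chaining these needs the factors to be
   nonnegative.  When L is known and x^0 is not a minimizer, mu <= L <= L n.
   When L is unknown, grad f(y^k) <> 0 makes f(y^k) > f(xs), and
   f(x^{k+1}) >= f(xs) then forces the sign. *)

Require Import Defs.
From mathcomp Require Import all_boot all_order all_algebra.
From mathcomp Require Import all_classical all_reals all_analysis.
From mathcomp Require Import ring lra.

Set Implicit Arguments.
Unset Strict Implicit.
Unset Printing Implicit Defensive.

Import Order.TTheory GRing.Theory Num.Theory.
Import numFieldNormedType.Exports.

Local Open Scope classical_set_scope.
Local Open Scope ring_scope.

(** * Euclidean inner product and norm *)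

Lemma dotrDr (R : realType) (N : nat) (u w z : 'rV[R]_N) :
  dotr u (w + z) = dotr u w + dotr u z.
Proof.
by rewrite /dotr -big_split; apply: eq_bigr => j _; rewrite mxE mulrDr.
Qed.

Lemma dotrZr (R : realType) (N : nat) (c : R) (u w : 'rV[R]_N) :
  dotr u (c *: w) = c * dotr u w.
Proof.
by rewrite /dotr mulr_sumr; apply: eq_bigr => j _; rewrite mxE mulrCA.
Qed.

Lemma dotrC (R : realType) (N : nat) (u w : 'rV[R]_N) : dotr u w = dotr w u.
Proof. by apply: eq_bigr => j _; rewrite mulrC. Qed.

Lemma dotrDl (R : realType) (N : nat) (u w z : 'rV[R]_N) :
  dotr (u + w) z = dotr u z + dotr w z.
Proof. by rewrite dotrC dotrDr !(dotrC z). Qed.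

Lemma dotrZl (R : realType) (N : nat) (c : R) (u w : 'rV[R]_N) :
  dotr (c *: u) w = c * dotr u w.
Proof. by rewrite dotrC dotrZr dotrC. Qed.

Lemma dotrNl (R : realType) (N : nat) (u w : 'rV[R]_N) :
  dotr (- u) w = - dotr u w.
Proof. by rewrite -scaleN1r dotrZl mulN1r. Qed.

Lemma dotrr_ge0 (R : realType) (N : nat) (u : 'rV[R]_N) : 0 <= dotr u u.
Proof. by apply: sumr_ge0 => j _; rewrite -expr2 sqr_ge0. Qed.

Lemma dotrr_eq0 (R : realType) (N : nat) (u : 'rV[R]_N) :
  (dotr u u == 0) = (u == 0).
Proof.
apply/eqP/eqP => [u0|->]; last by apply: big1 => j _; rewrite mxE mul0r.
apply/rowP => j; rewrite mxE; apply/eqP; rewrite -sqrf_eq0 expr2; apply/eqP.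
by apply: (psumr_eq0P _ u0) => // l _; rewrite -expr2 sqr_ge0.
Qed.

Lemma norm2_ge0 (R : realType) (N : nat) (u : 'rV[R]_N) : 0 <= norm2 u.
Proof. exact: sqrtr_ge0. Qed.

Lemma sqr_norm2 (R : realType) (N : nat) (u : 'rV[R]_N) :
  norm2 u ^+ 2 = dotr u u.
Proof. by rewrite sqr_sqrtr // dotrr_ge0. Qed.

Lemma sqr_norm2DZ (R : realType) (N : nat) (c : R) (u w : 'rV[R]_N) :
  norm2 (u + c *: w) ^+ 2 =
    norm2 u ^+ 2 + 2 * c * dotr u w + c ^+ 2 * norm2 w ^+ 2.
Proof.
by rewrite !sqr_norm2 !(dotrDl, dotrDr, dotrZl, dotrZr) (dotrC w u); ring.
Qed.

Lemma norm2Z (R : realType) (N : nat) (c : R) (u : 'rV[R]_N) :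
  norm2 (c *: u) = `|c| * norm2 u.
Proof.
by rewrite /norm2 dotrZl dotrZr mulrA -expr2 sqrtrM ?sqr_ge0// sqrtr_sqr.
Qed.

(** Cauchy-Schwarz: the square of the norm of [norm2 w *: u - norm2 u *: w] expands to twice
    [norm2 u * norm2 w] times the gap. That factor can be cancelled unless a norm vanishes, hence
    the two degenerate cases. *)
Lemma dotr_le_norm2 (R : realType) (N : nat) (u w : 'rV[R]_N) :
  dotr u w <= norm2 u * norm2 w.
Proof.
have dot0 (z z' : 'rV[R]_N) : norm2 z = 0 -> dotr z z' = 0.
  move=> z0; have /eqP : dotr z z = 0 by rewrite -sqr_norm2 z0 expr0n.
  by rewrite dotrr_eq0 => /eqP ->; rewrite -(scale0r 0) dotrZl mul0r.
have [u0|u0] := eqVneq (norm2 u) 0; first by rewrite dot0// u0 mul0r.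
have [w0|w0] := eqVneq (norm2 w) 0; first by rewrite dotrC dot0// w0 mulr0.
have ab0 : 0 < norm2 u * norm2 w by rewrite mulr_gt0// lt_def norm2_ge0 ?u0 ?w0.
have := dotrr_ge0 (norm2 w *: u + (- norm2 u) *: w).
rewrite !(dotrDl, dotrDr, dotrZl, dotrZr) (dotrC w u) -!sqr_norm2 => h.
rewrite -subr_ge0 -(pmulr_rge0 _ ab0).
nra.
Qed.

(** * Directional derivatives and the quadratic bounds from a Lipschitz gradient *)

Lemma derive_dotr_grad (R : realType) (N : nat) (f : 'rV[R]_N -> R)
    (x d : 'rV[R]_N) :
  differentiable f x -> 'D_d f x = dotr (grad f x) d.
Proof.
move=> df; rewrite deriveE// {1}(row_sum_delta d) raddf_sum.
apply: eq_bigr => j _; rewrite mxE deriveE// mulrC; exact: linearZ.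
Qed.

Lemma is_derive_line (R : realType) (N : nat) (f : 'rV[R]_N -> R)
    (x d : 'rV[R]_N) (t : R) :
  differentiable f (x + t *: d) ->
  is_derive t 1 (fun s : R => f (x + s *: d)) (dotr (grad f (x + t *: d)) d).
Proof.
move=> df.
(* The difference quotient of the restriction to the line at [t] is that of [f] at [x + t *: d] in
   direction [d], so the derivative transfers without a chain rule. *)
have E : (fun h : R => h^-1 *: (((fun s : R => f (x + s *: d)) \o shift t)
             (h *: (1 : R)) - f (x + t *: d))) =
         (fun h : R => h^-1 *: ((f \o shift (x + t *: d)) (h *: d)
             - f (x + t *: d))).
  apply/funext => h /=; congr (_ *: (f _ - _)).
  by rewrite scalerDl /GRing.scale/= mulr1 addrCA.
apply: DeriveDef; first by rewrite /derivable E; apply: diff_derivable.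
by rewrite -derive_dotr_grad// /derive E.
Qed.

(** The mean value theorem replaces integration: [phi] is [f] on the segment minus the linear and
    quadratic terms, and Cauchy-Schwarz with the Lipschitz bound makes its derivative
    nonpositive. *)
Lemma lipschitz_grad_descent (R : realType) (N : nat) (L : R)
    (f : 'rV[R]_N -> R) (x d : 'rV[R]_N) :
  (forall z, differentiable f z) -> lipschitz_grad L f ->
  f (x + d) <= f x + dotr (grad f x) d + L / 2 * norm2 d ^+ 2.
Proof.
move=> df lf.
pose c := dotr (grad f x) d; pose e := L / 2 * norm2 d ^+ 2.
pose phi (t : R) := f (x + t *: d) - t * c - t ^+ 2 * e.
pose dphi (t : R) := dotr (grad f (x + t *: d)) d - c - 2 * t * e.
have dp (t : R) : is_derive t (1 : R) phi (dphi t).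
  have df1 := is_derive_line (df (x + t *: d)).
  rewrite /phi; apply: is_derive_eq.
  by rewrite /dphi /GRing.scale/=; ring.
have cphi : {within `[0, 1], continuous phi}.
  apply: continuous_subspaceT => t; apply/differentiable_continuous.
  by apply/derivable1_diffP; case: (dp t).
have [t] := MVT ltr01 (fun t _ => dp t) cphi.
rewrite in_itv/= => /andP[t0 t1].
rewrite subr0 mulr1 /phi scale1r scale0r addr0 !mul1r mul0r expr0n/= mul0r !subr0.
rewrite expr1n mul1r => E.
suff : dphi t <= 0 by rewrite -/c -/e; lra.
have -> : dphi t = dotr (grad f (x + t *: d) - grad f x) d - t * (L * norm2 d ^+ 2).
  by rewrite dotrDl dotrNl /dphi /c /e; field.
rewrite subr_le0; apply: le_trans (dotr_le_norm2 _ _) _.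
have := lf (x + t *: d) x.
rewrite addrAC subrr add0r norm2Z gtr0_norm// => h.
apply: le_trans (ler_wpM2r (norm2_ge0 d) h) _.
by rewrite expr2 !mulrA (mulrC t L).
Qed.

(** The upper bound is applied from [x + d] back to [x], costing [L / 2]; moving the gradient from
    [x + d] to [x] costs another [L], whence [3 / 2]. *)
Lemma lipschitz_grad_ascent (R : realType) (N : nat) (L : R)
    (f : 'rV[R]_N -> R) (x d : 'rV[R]_N) :
  (forall z, differentiable f z) -> lipschitz_grad L f ->
  f x + dotr (grad f x) d - 3 / 2 * L * norm2 d ^+ 2 <= f (x + d).
Proof.
move=> df lf.
have := lipschitz_grad_descent (x + d) (- d) df lf.
rewrite addrK -(scaleN1r d) norm2Z normrN1 mul1r dotrZr.
have := dotr_le_norm2 (grad f x - grad f (x + d)) d.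
have := lf x (x + d); rewrite opprD addrA subrr add0r -(scaleN1r d) norm2Z normrN1 mul1r.
rewrite dotrDl dotrNl => h.
have := ler_wpM2r (norm2_ge0 d) h.
lra.
Qed.

(** * From strong convexity to the Polyak-Łojasiewicz condition *)

Lemma le0_of_le_small_mul (R : realType) (c e : R) :
  (forall t, 0 < t <= 1 -> c <= t * e) -> c <= 0.
Proof.
move=> H; rewrite leNgt; apply/negP => c0.
have e0 := normr_ge0 e.
have s0 : 0 < c + `|e| by rewrite ltr_wpDr.
(* If [c > 0], this [t] lies in (0, 1] and yet [t * e < c], because [e < c + |e|]. *)
have t0 : 0 < c / (c + `|e|) by rewrite divr_gt0.
have := H (c / (c + `|e|)); rewrite t0 ler_pdivrMr// mul1r lerDl e0 => /(_ isT).
apply/negP; rewrite -ltNge mulrAC ltr_pdivrMr// ltr_pM2l//.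
by rewrite ltr_pwDl// ler_norm.
Qed.

(** Dividing the strong convexity inequality on the segment towards [xs] by [t] and letting [t] tend
    to 0 gives the quadratic lower bound [key]. Completing the square in [grad f x + mu *: d] then
    eliminates [d]. *)
Lemma strongly_convex_PL (R : realType) (N : nat) (L mu : R)
    (f : 'rV[R]_N -> R) (xs : 'rV[R]_N) :
  (forall z, differentiable f z) -> lipschitz_grad L f -> 0 < mu ->
  strongly_convex mu f -> polyak_lojasiewicz mu f xs.
Proof.
move=> df lf mu0 sc x.
pose d := xs - x; pose q := norm2 d ^+ 2.
have key : dotr (grad f x) d + mu / 2 * q - (f xs - f x) <= 0.
  (* The constant collects the second-order terms in [t]: [3 / 2 * L] from the lower bound on
     [f (x + t *: d)], and [mu / 2] from the factor [t * (1 - t)]. *)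
  apply: (@le0_of_le_small_mul _ _ ((3 / 2 * L + mu / 2) * q)) => t /andP[t0 t1].
  have := sc xs x t; rewrite (ltW t0) t1 => /(_ isT).
  have -> : t *: xs + (1 - t) *: x = x + t *: d.
    by rewrite /d scalerBr scalerBl scale1r addrCA addrA.
  have := lipschitz_grad_ascent x (t *: d) df lf.
  rewrite dotrZr norm2Z exprMn gtr0_norm// -/d -/q => h1 h2.
  rewrite -(ler_pM2l t0); nra.
have := sqr_ge0 (norm2 (grad f x + mu *: d)).
rewrite sqr_norm2DZ -/q.
nra.
Qed.

(** * Block gradients and exact block minimization *)

Lemma sum_block_grad (R : realType) (N n : nat) (I : 'I_n -> {set 'I_N})
    (f : 'rV[R]_N -> R) (x : 'rV[R]_N) :
  block_partition I ->
  norm2 (grad f x) ^+ 2 = \sum_(i < n) norm2 (block_grad I i f x) ^+ 2.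
Proof.
move=> [Icov Idisj]; rewrite sqr_norm2 /dotr.
pose E (j : 'I_N) := grad f x 0 j * grad f x 0 j.
transitivity (\sum_(j in (\bigcup_(i < n) I i)%SET) E j).
  by rewrite Icov; apply: eq_bigl => j; rewrite inE.
rewrite (partition_disjoint_bigcup _ _ Idisj); apply: eq_bigr => i _.
rewrite sqr_norm2 /dotr big_enum_val; apply: eq_bigr => l _.
by rewrite /E !mxE.
Qed.

(** The exact minimizer does at least as well as a gradient step of length [L^-1] inside the block,
    along the gradient [g] with its other coordinates set to 0. *)
Lemma block_min_descent (R : realType) (N n : nat) (I : 'I_n -> {set 'I_N})
    (L : R) (f : 'rV[R]_N -> R) (i : 'I_n) (y z : 'rV[R]_N) :
  (forall x, differentiable f x) -> lipschitz_grad L f -> 0 < L ->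
  is_argmin (block_space I i y) f z ->
  f z <= f y - (2 * L)^-1 * norm2 (block_grad I i f y) ^+ 2.
Proof.
move=> df lf L0 [_ zmin].
pose g := \row_(j < N) if j \in I i then grad f y 0 j else 0.
have gE : dotr g g = norm2 (block_grad I i f y) ^+ 2.
  rewrite sqr_norm2 /dotr.
  transitivity (\sum_(j in I i) grad f y 0 j * grad f y 0 j).
    rewrite [RHS]big_mkcond; apply: eq_bigr => j _; rewrite mxE.
    by case: ifP => // _; rewrite mulr0.
  by rewrite big_enum_val; apply: eq_bigr => l _; rewrite !mxE.
have gfE : dotr (grad f y) g = dotr g g.
  apply: eq_bigr => j _; rewrite [g 0 j]mxE.
  by case: ifP => // _; rewrite !mulr0.
have /zmin : block_space I i y (y + (- L^-1) *: g).
  exists ((- L^-1) *: g) => //=; apply: rpredZ.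
  rewrite (row_sum_delta g); apply: rpred_sum => j _; rewrite mxE.
  case: ifP => jI; last by rewrite scale0r rpred0.
  by apply/rpredZ/memv_span/map_f; rewrite mem_enum.
move=> /le_trans; apply.
apply: le_trans (lipschitz_grad_descent _ _ df lf) _.
rewrite dotrZr norm2Z exprMn real_normK ?num_real// (sqr_norm2 g) gfE gE.
rewrite le_eqVlt; apply/orP; left; apply/eqP.
by field; rewrite gt_eqF.
Qed.

(** * Gradient steps compared with the minimum value *)

Lemma grad_descent_min (R : realType) (N : nat) (L s : R)
    (f : 'rV[R]_N -> R) (xs x : 'rV[R]_N) :
  (forall z, differentiable f z) -> lipschitz_grad L f ->
  is_argmin setT f xs ->
  s * (2 - L * s) * norm2 (grad f x) ^+ 2 <= 2 * (f x - f xs).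
Proof.
move=> df lf [_ /(_ (x + (- s) *: grad f x) I) fmin].
have := lipschitz_grad_descent x ((- s) *: grad f x) df lf.
rewrite dotrZr norm2Z exprMn real_normK ?num_real// -sqr_norm2.
by nra.
Qed.

Lemma argmin_grad_eq0 (R : realType) (N : nat) (L : R)
    (f : 'rV[R]_N -> R) (xs x : 'rV[R]_N) :
  (forall z, differentiable f z) -> lipschitz_grad L f ->
  is_argmin setT f xs -> f x = f xs -> grad f x = 0.
Proof.
move=> df lf fmin fx; apply/eqP; rewrite -dotrr_eq0 -sqr_norm2 eq_le sqr_ge0 andbT.
(* The sign of [L] is not known here; the step length [s = (|L| + 1)^-1] still makes
   [s * (2 - L * s)] positive. *)
have L1 : 0 < `|L| + 1 by rewrite ltr_wpDl.
have := grad_descent_min (`|L| + 1)^-1 x df lf fmin.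
rewrite fx subrr mulr0 pmulr_rle0// mulr_gt0 ?invr_gt0//.
by rewrite subr_gt0 ltr_pdivrMr//; have := ler_norm L; lra.
Qed.

(** A gradient step of length [L^-1] bounds the squared gradient by [2 * L * (f x - f xs)], while
    the Polyak-Łojasiewicz condition bounds it below by [2 * mu * (f x - f xs)]; the positive gap
    cancels. *)
Lemma PL_le_lipschitz (R : realType) (N : nat) (L mu : R)
    (f : 'rV[R]_N -> R) (xs x : 'rV[R]_N) :
  (forall z, differentiable f z) -> lipschitz_grad L f -> 0 < L ->
  is_argmin setT f xs -> polyak_lojasiewicz mu f xs -> f xs < f x -> mu <= L.
Proof.
move=> df lf L0 fmin pl fx.
have := grad_descent_min L^-1 x df lf fmin.
have -> : L^-1 * (2 - L * L^-1) = L^-1 by field; rewrite gt_eqF.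
rewrite mulrC ler_pdivrMr// => /(le_trans (pl x)).
by rewrite mulrAC ler_pM2l ?mulr_gt0 ?subr_gt0 // => h; nra.
Qed.

(** * Decrease in one iteration, and the convergence bound *)

Lemma max_block_min_descent (R : realType) (N n : nat) (I : 'I_n -> {set 'I_N})
    (L : R) (f : 'rV[R]_N -> R) (i : 'I_n) (y z : 'rV[R]_N) :
  block_partition I ->
  (forall x, differentiable f x) -> lipschitz_grad L f -> 0 < L ->
  is_argmax setT (fun i' => norm2 (block_grad I i' f y) ^+ 2) i ->
  is_argmin (block_space I i y) f z ->
  f z <= f y - 1 / (L * n%:R) / 2 * norm2 (grad f y) ^+ 2.
Proof.
move=> hI df lf L0 [_ imax] /(block_min_descent df lf L0) /le_trans; apply.
have n0 : 0 < n%:R :> R by rewrite ltr0n (leq_ltn_trans _ (ltn_ord i)).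
have : norm2 (grad f y) ^+ 2 <= n%:R * norm2 (block_grad I i f y) ^+ 2.
  rewrite (sum_block_grad f y hI).
  apply: le_trans (ler_sum _ (fun i' _ => imax i' Logic.I)) _.
  by rewrite sumr_const card_ord mulr_natl.
have c0 : 0 < 1 / (L * n%:R) / 2 by rewrite !divr_gt0 ?mulr_gt0.
rewrite -(ler_pM2l c0); set c := _ / 2; set q := norm2 (block_grad _ _ _ _) ^+ 2.
have -> : c * (n%:R * q) = (2 * L)^-1 * q by rewrite /c; field; rewrite !gt_eqF.
lra.
Qed.

(** In the known-L variant this extracts the signs of [L] and [n] from the step-size equation, whose
    left side is positive. Since the inverse of 0 is 0, positivity also excludes [n = 0]. *)
Lemma inv_mul_natr_gt0 (R : realFieldType) (L : R) (n : nat) :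
  0 < 1 / (L * n%:R) -> 0 < L /\ (0 < n)%N.
Proof.
rewrite div1r invr_gt0; case: n => [|n]; first by rewrite mulr0 ltxx.
by rewrite pmulr_lgt0 ?ltr0n.
Qed.

Theorem mainTheorem3 (R : realType) (N n : nat) (I : 'I_n -> {set 'I_N})
    (hI : block_partition I)
    (f : 'rV[R]_N -> R) (L mu : R) (xs : 'rV[R]_N)
    (f_convex : convex_function [set: convex_lmodType 'rV[R]_N] f)
    (f_diff : forall x : 'rV[R]_N, differentiable f x)
    (f_lip : lipschitz_grad L f)
    (f_min : is_argmin [set: 'rV[R]_N] f xs)
    (mu_gt0 : 0 < mu)
    (f_mu : strongly_convex mu f \/ polyak_lojasiewicz mu f xs)
    (f_block_min : forall (i : 'I_n) (x : 'rV[R]_N),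
      exists z, is_argmin (block_space I i x) f z)
    (var : aam_variant) (x y v : nat -> 'rV[R]_N) (a A : nat -> R) (k : nat)
    (run : aam_run I L var f x y v a A k) :
  f (x k.+1) - f xs <=
    \prod_(i < k) (1 - mu / Lhat a A i) * (f (x 0%N) - f xs).
Proof.
have pl : polyak_lojasiewicz mu f xs.
  by case: f_mu => // sc; exact: strongly_convex_PL f_lip mu_gt0 sc.
have f_ge z : f xs <= f z by case: f_min => _; exact.
have fy j : (j <= k)%N -> f (y j) <= f (x j).
  move=> /(aam_y run) [b [[_ bmin] ->]].
  by have := bmin 0; rewrite scale0r addr0; apply; rewrite /= in_itv/= lexx ler01.
have fx j : (j <= k)%N -> f (x j.+1) <= f (y j).
  move=> /(aam_x run) [i [_ [_ xmin]]]; apply: xmin.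
  by exists 0; rewrite ?addr0//=; exact: rpred0.
have A_ge0 j : (j <= k)%N -> 0 <= A j.
  elim: j => [|j IH] jk; first by rewrite (aam_A0 run).
  by rewrite (aam_A run jk) addr_ge0 ?IH 1?ltnW//; case: (aam_a run jk) => /ltW.
(* This ratio is the inverse of [Lhat a A j], the form in which both step-size rules provide it. *)
have step_gt0 j : (j < k)%N -> 0 < a j.+1 ^+ 2 / (A j + a j.+1).
  move=> jk; have [a0 _] := aam_a run jk.
  by rewrite divr_gt0 ?exprn_gt0// ltr_wpDl// A_ge0// ltnW.
have step j : (j < k)%N ->
    f (x j.+1) - f xs <= (1 - mu / Lhat a A j) * (f (y j) - f xs).
  move=> jk; have r0 := step_gt0 _ jk; have [_ astep] := aam_a run jk.
  suff h : f (x j.+1) <=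
      f (y j) - (a j.+1 ^+ 2 / (A j + a j.+1)) / 2 * norm2 (grad f (y j)) ^+ 2.
    rewrite /Lhat invf_div; move: r0 h; set r := _ / _ => r0 h.
    by have := ler_wpM2l (ltW r0) (pl (y j)); lra.
  have [i [imax imin]] := aam_x run (ltnW jk).
  case: var run astep => [run astep|_ [_ <-]]; last first.
    by rewrite invfM; lra.
  move: r0; rewrite astep => /inv_mul_natr_gt0 [L0 _].
  exact: max_block_min_descent imax imin.
have factor_ge0 j : (j < k)%N -> f xs < f (x 0%N) -> 0 <= 1 - mu / Lhat a A j.
  move=> jk fx0; have := step _ jk; have := f_ge (x j.+1).
  have r0 := step_gt0 _ jk; have [_ astep] := aam_a run jk.
  rewrite /Lhat invf_div; case: var run astep => [run astep|_ [gy _]]; last first.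
    have yj : f xs < f (y j).
      rewrite lt_def f_ge andbT; apply: contraNneq gy => fyj.
      by rewrite (argmin_grad_eq0 f_diff f_lip f_min fyj).
    move=> h1 h2; rewrite -(pmulr_lge0 _ (_ : 0 < f (y j) - f xs)) ?subr_gt0//.
    by apply: le_trans h2; rewrite subr_ge0.
  move=> _ _; move: r0; rewrite astep => /inv_mul_natr_gt0 [L0 n0].
  have muL := PL_le_lipschitz f_diff f_lip L0 f_min pl fx0.
  rewrite mulrA mulr1 subr_ge0 ler_pdivrMr ?mulr_gt0 ?ltr0n// mul1r.
  by apply: le_trans muL _; rewrite ler_peMr ?ler1n// ltW.
(* If [x 0] is already a minimizer, the right side is 0 whatever the signs of the factors, and
   monotonicity along the run suffices. *)
have [fx0|fx0] := eqVneq (f (x 0%N)) (f xs).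
  rewrite fx0 subrr mulr0 subr_le0 -fx0.
  suff mono j : (j <= k.+1)%N -> f (x j) <= f (x 0%N) by exact: mono.
  elim: j => // j IH jk; apply: le_trans (fx _ jk) _.
  by apply: le_trans (fy _ jk) (IH _); exact: ltnW.
have {}fx0 : f xs < f (x 0%N) by rewrite lt_def fx0 f_ge.
(* Iteration [k] contributes only monotonicity: the run fixes step sizes for iterations below [k],
   which is why the product has [k] factors although the bound concerns [x k.+1]. *)
apply: le_trans (_ : f (x k) - f xs <= _).
  by rewrite lerD2r; apply: le_trans (fx _ _) (fy _ _).
(* The bound lets the induction vary the index while the run keeps its length [k]. *)
have : (k <= k)%N by [].
elim: {-2}k => [|j IH] jk; first by rewrite big_ord0 mul1r.
rewrite big_ord_recr/= mulrAC mulrC.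
apply: le_trans (step _ jk) _; apply: ler_wpM2l; first exact: factor_ge0.
by apply: le_trans (IH (ltnW jk)); rewrite lerD2r fy// ltnW.
Qed.
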